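(* Let $\bar\gamma_{\mathrm{E}}>0$, $\mathcal{R}>0$ and $\alpha>0$ be fixed, and let $\bar\gamma_{\mathrm{D}}>0$ with $\bar\gamma_{\mathrm{R}}=\alpha\bar\gamma_{\mathrm{D}}$. Let $h_{\mathrm{S},\mathrm{R}},h_{\mathrm{R},\mathrm{D}},h_{\mathrm{R},\mathrm{E}}$ be independent $\mathcal{CN}(0,1)$ random variables, and define $$\mathcal{R}^{1}_{\mathrm{R}\to\mathrm{D}}=\max\left\{\log_2\frac{1+\bar\gamma_{\mathrm{D}}|h_{\mathrm{R},\mathrm{D}}|^2}{1+\bar\gamma_{\mathrm{E}}|h_{\mathrm{R},\mathrm{E}}|^2},0\right\},\qquad \mathcal{R}^{1}_{\mathrm{S}\to\mathrm{R}}=\log_2\left(1+\bar\gamma_{\mathrm{R}}|h_{\mathrm{S},\mathrm{R}}|^2\right),$$ $\mathcal{R}_1=\max\{\min\{\mathcal{R}^{1}_{\mathrm{R}\to\mathrm{D}},\mathcal{R}^{1}_{\mathrm{S}\to\mathrm{R}}\},0\}$ and $\mathcal{P}_1=\Pr(\mathcal{R}_1<\mathcal{R})$ (a function of $\bar\gamma_{\mathrm{D}}$). Then as $\bar\gamma_{\mathrm{D}}\to\infty$, $$\mathcal{P}_1\approx\mathcal{M}_1\bar\gamma_{\mathrm{D}}^{-1},$$ in the sense that $\bar\gamma_{\mathrm{D}}\mathcal{P}_1\to\mathcal{M}_1$, where $\mathcal{M}_1=(2^{\mathcal{R}}-1)(1+1/\alpha)+2^{\mathcal{R}}\bar\ga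mma_{\mathrm{E}}>0$.
   Context: $\mathcal{CN}(0,1)$ denotes a circularly symmetric complex Gaussian random variable with zero mean and unit variance (Rayleigh fading). The quantities model a decode-and-forward relay system where the eavesdropper overhears only the relay; $\bar\gamma$'s are average SNRs, $\mathcal{R}_1$ the secrecy capacity and $\mathcal{P}_1$ the secrecy outage probability. *)

(* Defs.v *)
From HB Require Import structures.
From mathcomp Require Import all_boot all_order all_algebra.
From mathcomp Require Import all_classical all_reals all_analysis.
Set Implicit Arguments. Unset Strict Implicit. Unset Printing Implicit Defensive.
Import Order.TTheory GRing.Theory Num.Theory.
Import numFieldNormedType.Exports.
Local Open Scope classical_set_scope.
Local Open Scope ring_scope.

Definition log2 {R : realType} (x : R) : R := ln x / ln 2.

(** A complex number is represented by the pair (real part, imaginary part). *)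

(** [h] is a circularly symmetric complex Gaussian CN(0,1) random variable:
    (Re h, Im h) has the density z |-> exp(-|z|^2)/pi on R^2 with respect to the
    product Lebesgue measure (i.e. Re h, Im h are i.i.d. N(0,1/2)). *)
Definition is_CN01 {d} {T : measurableType d} {R : realType}
  (P : probability T R) (h : T -> R * R) : Prop :=
  measurable_fun setT h /\
  forall A : set (R * R), measurable A ->
    P (h @^-1` A) =
    (\int[(@lebesgue_measure R \x @lebesgue_measure R)%E]_(z in A)
        (expR (- (z.1 ^+ 2 + z.2 ^+ 2)) / pi)%:E)%E.

Definition indep3 {d} {T : measurableType d} {R : realType}
  (P : probability T R) (X Y Z : T -> R * R) : Prop :=
  forall A B C : set (R * R), measurable A -> measurable B -> measurable C ->
    P (X @^-1` A `&` Y @^-1` B `&` Z @^-1` C) =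
    (P (X @^-1` A) * P (Y @^-1` B) * P (Z @^-1` C))%E.

Definition cabs2 {R : realType} (z : R * R) : R := z.1 ^+ 2 + z.2 ^+ 2.

Definition rate_RD {R : realType} (gD gE : R) (hRD hRE : R * R) : R :=
  Num.max (log2 ((1 + gD * cabs2 hRD) / (1 + gE * cabs2 hRE))) 0.

Definition rate_SR {R : realType} (gR : R) (hSR : R * R) : R :=
  log2 (1 + gR * cabs2 hSR).

Definition rate1 {R : realType} (alpha gD gE : R) (hSR hRD hRE : R * R) : R :=
  Num.max (Num.min (rate_RD gD gE hRD hRE) (rate_SR (alpha * gD) hSR)) 0.

Definition P1 {d} {T : measurableType d} {R : realType} (P : probability T R)
  (hSR hRD hRE : T -> R * R) (alpha gE Rt gD : R) : R :=
  fine (P [set w | rate1 alpha gD gE (hSR w) (hRD w) (hRE w) < Rt]).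

Definition M1 {R : realType} (alpha gE Rt : R) : R :=
  (2 `^ Rt - 1) * (1 + 1 / alpha) + 2 `^ Rt * gE.

(* Main.v *)
Require Import Defs.
From HB Require Import structures.
From mathcomp Require Import all_boot all_order all_algebra.
From mathcomp Require Import all_classical all_reals all_analysis.
From mathcomp Require Import measurable_realfun ring lra.
Import Order.TTheory GRing.Theory Num.Theory.
Import numFieldNormedType.Exports.
Local Open Scope classical_set_scope.
Local Open Scope ring_scope.

(** By scaling, the area of the disc of squared radius [s] is [s] times that of
    the unit disc; hence the plane Lebesgue measure pushed forward by [cabs2] is
    a multiple of the Lebesgue measure on the half-line, and the squared modulus
    of a CN(0,1) variable is exponential of rate 1, the constant being fixed by
    total mass 1.  With [c = 2^Rt - 1] and [b = 2^Rt gE], the link is not in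
    outage iff [c <= alpha gD |hSR|^2] and [c + b |hRE|^2 <= gD |hRD|^2], so by
    independence
      [P1 = 1 - expR (- c (1 + 1 / alpha) / gD) / (1 + b / gD)],
    whose first-order term in [1 / gD] is [M1 / gD]. *)

(** * Image measures *)

Section pushforward_measure.
Context d1 d2 (T1 : measurableType d1) (T2 : measurableType d2) (R : realType).

(* [pushforward] is canonically a measure only up to a proof of measurability,
   which unification cannot find. *)
Definition pushforward_measure (m : {measure set T1 -> \bar R}) (f : T1 -> T2)
    (mf : measurable_fun setT f) : {measure set T2 -> \bar R} :=
  @measure_function_pushforward__canonical__measure_function_Measure
    _ _ _ _ _ m f mf.

End pushforward_measure.
Arguments pushforward_measure {d1 d2 T1 T2 R} m {f} mf.

(** * Scaling of Lebesgue measure on the line and in the plane *)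

Section planar_lebesgue_measure.
Context {R : realType}.
Local Open Scope ereal_scope.
Local Notation mu := (@lebesgue_measure R).
Local Notation mu2 := (mu \x mu).

(** Lebesgue measure is determined by its values on half-open intervals, and [*%R k] pulls []a, b]]
    back to []a / k, b / k]]. *)
Lemma lebesgue_measure_scale (k : R) (A : set R) : (0 < k)%R -> measurable A ->
  mu A = k%:E * mu ( *%R k @^-1` A).
Proof.
move=> k0 mA.
have mk : measurable_fun [set: measurableTypeR R]
    ( *%R k : measurableTypeR R -> measurableTypeR R).
  exact: measurable_funM.
pose m : {measure set (measurableTypeR R) -> \bar R} :=
  mscale (NngNum (ltW k0)) (pushforward_measure mu mk).
rewrite -[RHS]/(m A); apply: lebesgue_measure_unique => // _ [[a b]] _ <- /=.
rewrite /m /mscale /= /pushforward.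
have -> : *%R k @^-1` `]a, b]%classic = `](a / k)%R, (b / k)%R]%classic.
  by apply/seteqP; split => x /=; rewrite !in_itv /= (mulrC k);
    rewrite ltr_pdivrMr// ler_pdivlMr.
rewrite !lebesgue_measure_itv /= !lte_fin ltr_pM2r ?invr_gt0//.
case: ifPn => _; last by rewrite mule0.
by rewrite -!EFinB -EFinM; congr EFin; field; rewrite gt_eqF.
Qed.

(** The product measure is determined by rectangles, where each side contributes one factor [k]. *)
Lemma planar_lebesgue_measure_scale (k : R) (A : set (R * R)) :
  (0 < k)%R -> measurable A ->
  mu2 A = (k ^+ 2)%:E * mu2 ((fun z => (k * z.1, k * z.2)%R) @^-1` A).
Proof.
move=> k0 mA.
pose RR := (measurableTypeR R * measurableTypeR R)%type.
pose f (z : RR) : RR := (k * z.1, k * z.2)%R.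
have mf : measurable_fun setT f.
  by apply/measurable_fun_pairP; split; apply: (@measurable_funM _ _ R).
pose m : {measure set RR -> \bar R} :=
  mscale (NngNum (exprn_ge0 2 (ltW k0))) (pushforward_measure mu2 mf).
rewrite -[RHS]/(m A).
apply: (@product_measure_unique _ _ _ _ R mu mu m) => // B C mB mC.
rewrite -[LHS]/((k ^+ 2)%:E *
  mu2 (( *%R k @^-1` B) `*` ( *%R k @^-1` C))).
have mk D : measurable D -> measurable ( *%R k @^-1` D).
  move=> mD; rewrite -[X in measurable X]setTI.
  by apply: (measurable_funM (f := cst k)).
rewrite product_measure1E//; [|exact: mk..].
rewrite [X in _ = X * _](lebesgue_measure_scale k B)//.
rewrite [X in _ = _ * X](lebesgue_measure_scale k C)//.
by rewrite expr2 EFinM muleACA.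
Qed.

End planar_lebesgue_measure.

(** * Disc areas and the image of plane Lebesgue measure under [cabs2] *)

Section squared_modulus.
Context {R : realType}.
Local Open Scope ereal_scope.
Local Notation mu := (@lebesgue_measure R).
Local Notation mu2 := (mu \x mu).

Lemma cabs2_ge0 (z : R * R) : (0 <= cabs2 z)%R.
Proof. by rewrite addr_ge0 ?sqr_ge0. Qed.

Lemma measurable_cabs2 : measurable_fun setT (@cabs2 R).
Proof. by apply: measurable_funD; apply: measurable_funX. Qed.

Lemma measurable_disc (s : R) : measurable (@cabs2 R @^-1` `]-oo, s[%classic).
Proof. by rewrite -[X in measurable X]setTI; exact: measurable_cabs2. Qed.

(** The unit disc lies in a square of side 2. Finiteness lets its area serve as a real scaling
    factor. *)
Lemma disc_area_fin_num :
  mu2 (@cabs2 R @^-1` `]-oo, 1%R[%classic) \is a fin_num.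
Proof.
rewrite ge0_fin_numE ?measure_ge0//.
have mI : measurable (`](-1)%R, 1%R[%classic : set R) by [].
apply: (@le_lt_trans _ _
    (mu2 (`](-1)%R, 1%R[%classic `*` `](-1)%R, 1%R[%classic))).
  apply: le_measure; rewrite ?inE.
  - exact: measurable_disc.
  - exact: measurableX.
  - move=> [x y] /=; rewrite !in_itv /= /cabs2 /= => xy1.
    have := sqr_ge0 x; have := sqr_ge0 y => y0 x0.
    by split; rewrite -ltr_norml -(@expr_lt1 _ 2)// -normrX ger0_norm//; lra.
rewrite product_measure1E// lte_mul_pinfty//.
- by rewrite [X in X \is a fin_num]lebesgue_measure_itv /= lte_fin; case: ifP.
- rewrite [ltLHS]lebesgue_measure_itv /= lte_fin.
  by case: ifP => _ //; rewrite ltry.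
Qed.

Lemma disc_area (s : R) : (0 < s)%R ->
  mu2 (@cabs2 R @^-1` `]-oo, s[%classic) =
  s%:E * mu2 (@cabs2 R @^-1` `]-oo, 1%R[%classic).
Proof.
move=> s0; have sqs0 : (0 < Num.sqrt s)%R by rewrite sqrtr_gt0.
have discE : (fun z => (Num.sqrt s * z.1, Num.sqrt s * z.2)%R) @^-1`
    (@cabs2 R @^-1` `]-oo, s[%classic) = @cabs2 R @^-1` `]-oo, 1%R[%classic.
  by apply/seteqP; split => z /=;
    rewrite !in_itv /= /cabs2 !exprMn sqr_sqrtr ?ltW// -mulrDr gtr_pMr.
have := planar_lebesgue_measure_scale _ _ sqs0 (measurable_disc s).
by rewrite discE sqr_sqrtr ?ltW.
Qed.

(** Stands in for polar coordinates: the open rays []-oo, s[] are stable under intersection and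
    generate the Borel sets, and on them the claim reduces to [disc_area]. *)
Lemma pushforward_cabs2 (A : set R) :
  measurable A -> A `<=` `[0%R, +oo[%classic ->
  mu2 (@cabs2 R @^-1` A) =
  mu2 (@cabs2 R @^-1` `]-oo, 1%R[%classic) * mu A.
Proof.
move=> mA A0; set K := mu2 (_ @^-1` `]-oo, 1%R[%classic).
have K0 : (0 <= fine K)%R by rewrite fine_ge0// measure_ge0.
have KE : (fine K)%:E = K by rewrite fineK// disc_area_fin_num.
have m0y : measurable (`[0%R, +oo[%classic : set (measurableTypeR R)) by [].
pose m1 : {measure set (measurableTypeR R) -> \bar R} :=
  @pushforward_measure _ _ _ (measurableTypeR R) _ mu2 (@cabs2 R)
    measurable_cabs2.
(* As [cabs2] takes no negative value, the restriction to the half-line makes both measures vanish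
   on rays with [s <= 0]. *)
pose m2 : {measure set (measurableTypeR R) -> \bar R} :=
  mscale (NngNum K0) (mrestr mu m0y).
have rayE (s : R) : m1 `]-oo, s[%classic = m2 `]-oo, s[%classic.
  rewrite /m1 /m2 /= /mscale /= /mrestr /pushforward KE.
  have [s0|s0] := ltP 0%R s.
    rewrite disc_area// muleC; congr (_ * _).
    have -> : `]-oo, s[%classic `&` `[0%R, +oo[%classic = `[0%R, s[%classic.
      apply/seteqP; split => x /=; rewrite !in_itv /= ?andbT.
        by move=> [-> ->].
      by move=> /andP[-> ->].
    by rewrite lebesgue_measure_itv /= lte_fin s0 sube0.
  have -> : @cabs2 R @^-1` `]-oo, s[%classic = set0.
    rewrite -subset0 => z /=; rewrite in_itv /= => zs.
    by have := lt_le_trans zs s0; rewrite ltNge cabs2_ge0.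
  have -> : `]-oo, s[%classic `&` `[0%R, +oo[%classic = set0 :> set R.
    rewrite -subset0 => z /=; rewrite !in_itv /= andbT => -[zs z0].
    by have := lt_le_trans zs s0; rewrite ltNge z0.
  by rewrite !measure0 mule0.
suff : m1 A = m2 A.
  by rewrite /m1 /m2 /= /mscale /= /mrestr /pushforward KE setIidl.
apply: (@measure_unique _ _ (measurableTypeR R) (@RGenInftyO.G R)
  (fun n => `]-oo, n%:R[%classic)
  _ _ _ _ m1 m2) => //.
- exact: RGenInftyO.measurableE.
- move=> _ _ [x ->] [y ->]; exists (Num.min x y).
  by apply/seteqP; split => z /=; rewrite !in_itv /= lt_min => /andP.
- by move=> n; exists n%:R.
- rewrite -subTset => x _; exists (Num.truncn `|x|).+1 => //=.
  by rewrite in_itv /= (le_lt_trans (ler_norm x))// truncnS_gt.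
- by move=> _ [s ->].
(* Uniqueness also needs finite mass on the rays []-oo, n[], which exhaust the line. *)
- move=> n; rewrite rayE /m2 /= /mscale /= /mrestr.
  apply: (@le_lt_trans _ _ ((fine K)%:E * mu `[0%R, n%:R]%classic)).
    rewrite lee_wpmul2l ?lee_fin//; apply: le_measure; rewrite ?inE//.
      exact: measurableI.
    move=> x /=; rewrite !in_itv /= andbT => -[xn ->].
    by rewrite ltW.
  by rewrite lebesgue_measure_itv /= lte_fin; case: ifP => _;
    rewrite ?sube0 ?mule0 ?ltry// -EFinM ltry.
Qed.

End squared_modulus.

(** * The exponential law of the squared modulus *)

Section exponential_law.
Context {R : realType}.
Local Open Scope ereal_scope.
Local Notation mu := (@lebesgue_measure R).
Local Notation mu2 := (mu \x mu).

(** The density at [z] depends on [cabs2 z] alone, so its integral transports to the half-line,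
    where [expR (- s)] is the rate 1 exponential density. *)
Lemma CN01_cabs2_exponential {d} {T : measurableType d} (P : probability T R)
    (h : T -> R * R) (A : set R) : is_CN01 P h -> measurable A ->
  P (h @^-1` (@cabs2 R @^-1` A)) = exponential_prob 1 A.
Proof.
move=> [mh hP].
set K := mu2 (@cabs2 R @^-1` `]-oo, 1%R[%classic).
have K0 : (0 <= fine K)%R by rewrite fine_ge0// measure_ge0.
have KE : (fine K)%:E = K by rewrite fineK// disc_area_fin_num.
pose f (s : R) : \bar R := (expR (- s) / pi)%:E.
have f0 s : 0 <= f s by rewrite lee_fin divr_ge0 ?expR_ge0 ?pi_ge0.
have mf D : measurable_fun D f.
  by apply/measurable_EFinP/measurable_funTS; apply: measurable_funM => //;
    apply: measurableT_comp.
have lawE B : measurable B ->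
    P (h @^-1` (@cabs2 R @^-1` B)) = (fine K / pi)%:E * exponential_prob 1 B.
  move=> mB; pose B0 := B `&` `[0%R, +oo[%classic.
  have mB0 : measurable B0 by exact: measurableI.
  have -> : @cabs2 R @^-1` B = @cabs2 R @^-1` B0.
    apply/seteqP; split => z; last by case.
    by move=> ?; split => //=; rewrite in_itv /= cabs2_ge0.
  rewrite hP; last first.
    by rewrite -[X in measurable X]setTI; exact: measurable_cabs2.
  pose m : {measure set (measurableTypeR R) -> \bar R} :=
    @pushforward_measure _ _ _ (measurableTypeR R) _ mu2 (@cabs2 R)
      measurable_cabs2.
  transitivity (\int[m]_(s in B0) f s).
    apply/esym.
    exact: (@ge0_integral_pushforward _ _
      (measurableTypeR R * measurableTypeR R)%type (measurableTypeR R) _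
      (@cabs2 R) measurable_cabs2 mu2 B0 f mB0 (mf B0) (fun s _ => f0 s)).
  transitivity (\int[mscale (NngNum K0) mu]_(s in B0) f s).
    apply: eq_measure_integral => C mC CB0.
    rewrite /= /mscale /= KE [LHS]pushforward_cabs2//.
    exact: subset_trans CB0 (@subIsetr _ _ _).
  rewrite (ge0_integral_mscale mu mB0 (NngNum K0) (mf B0))//=.
  rewrite EFinM -muleA; congr (_ * _).
  have pi0 : 0 <= (pi^-1)%:E :> \bar R by rewrite lee_fin invr_ge0 pi_ge0.
  rewrite /exponential_prob -[RHS](ge0_integralZl mu)//; last 2 first.
  - apply: measurable_funTS; apply: measurableT_comp => //.
    exact: measurable_exponential_pdf.
  - by move=> s _; rewrite lee_fin exponential_pdf_ge0.
  rewrite integral_mkcondr; apply: eq_integral => s _.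
  rewrite /f /exponential_pdf !patchE; case: ifPn => _; last by rewrite mule0.
  by rewrite mul1r mulN1r -EFinM mulrC.
(* Both laws have total mass 1, so [lawE] at [setT] fixes the constant without computing the area of
   the disc. *)
move=> mA; suff KE1 : (fine K / pi)%:E = 1 :> \bar R.
  by rewrite lawE// KE1 mul1e.
have := lawE setT measurableT.
by rewrite !preimage_setT probability_setT /exponential_prob
  integral_exponential_pdf// mule1.
Qed.

Lemma exponential_tail (t : R) : (0 <= t)%R ->
  exponential_prob 1 `[t, +oo[ = (expR (- t))%:E.
Proof.
move=> t0.
transitivity (\int[mu]_(x in `[t, +oo[) (expR (- x))%:E).
  apply: eq_integral => x; rewrite inE /= in_itv /= andbT => tx.
  by rewrite exponential_pdfE ?(le_trans t0)// mul1r mulN1r.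
have cexp : continuous (fun x : R => expR (- x)).
  move=> x; apply: continuous_comp; last exact: continuous_expR.
  by apply: (@continuousN _ R^o _ id); exact: cvg_id.
rewrite (@ge0_continuous_FTC2y _ _ (fun x => - expR (- x))%R _ 0%R).
- by rewrite EFinN oppeK add0e.
- by move=> x _; exact: expR_ge0.
- exact: continuous_subspaceT.
- by rewrite -oppr0; apply: cvgN; exact: cvgr_expR.
- by move=> x _; exact: ex_derive.
- by apply: cvgN; apply/cvg_at_right_filter; exact: cexp.
- move=> x _; rewrite derive1E derive_val.
  by rewrite mulrN1 opprK.
Qed.

End exponential_law.

(** * Integration against a density, and measures determined by rectangles *)

Section finite_measures.
Context {R : realType}.
Local Open Scope ereal_scope.

(** [g] has the same integrals as the Radon-Nikodym derivative of [nu] over all measurable sets,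
    hence equals it [mu]-almost everywhere. *)
Lemma ge0_integral_density {d} {T : measurableType d}
    (nu : {measure set T -> \bar R})
    (mu : {sigma_finite_measure set T -> \bar R}) (f g : T -> \bar R) :
  nu setT < +oo -> measurable_fun setT g ->
  (forall A, measurable A -> nu A = \int[mu]_(x in A) g x) ->
  measurable_fun setT f -> (forall x, 0 <= f x) ->
  \int[nu]_x f x = \int[mu]_x (f x * g x).
Proof.
move=> nuT mg nug mf f0.
pose nu' : {finite_measure set T -> \bar R} := 
  mfrestr measurableT nuT.
have nu'E A : nu' A = nu A by rewrite /= /mfrestr /mrestr setIT.
have dom : nu' `<< mu.
  apply/null_content_dominatesP => A mA muA0.
  by rewrite nu'E nug// null_set_integral//; exact: measurable_funTS.
transitivity (\int[nu']_x f x).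
  by apply: eq_measure_integral => A _ _; exact/esym/nu'E.
rewrite -(Radon_Nikodym_SigmaFinite.change_of_variables dom)//.
have iRN := Radon_Nikodym_SigmaFinite.f_integrable dom.
have mRN := measurable_int _ iRN.
apply: ae_eq_integral => //; [exact: emeasurable_funM..|].
apply: ae_eqe_mul2l; apply: integral_ae_eq => // A _ mA.
by rewrite -Radon_Nikodym_SigmaFinite.f_integral// nu'E nug.
Qed.

(** By uniqueness [m] is the product of [m1] and [m2], which is by definition the integral of the
    measures of sections. *)
Lemma measure_of_rectangles {d1 d2} {T1 : measurableType d1}
    {T2 : measurableType d2} (m : {measure set (T1 * T2) -> \bar R})
    (m1 : {measure set T1 -> \bar R}) (m2 : {measure set T2 -> \bar R}) :
  m1 setT < +oo -> m2 setT < +oo ->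
  (forall A B, measurable A -> measurable B -> m (A `*` B) = m1 A * m2 B) ->
  forall S, measurable S -> m S = \int[m1]_x m2 (xsection S x).
Proof.
move=> m1T m2T mE S mS.
pose m1' : {finite_measure set T1 -> \bar R} :=
  mfrestr measurableT m1T.
pose m2' : {finite_measure set T2 -> \bar R} :=
  mfrestr measurableT m2T.
have m1'E A : m1' A = m1 A by rewrite /= /mfrestr /mrestr setIT.
have m2'E A : m2' A = m2 A by rewrite /= /mfrestr /mrestr setIT.
rewrite -(@product_measure_unique _ _ _ _ _ m1' m2' m)//; last first.
  by move=> A B mA mB; rewrite mE//; congr (_ * _); apply/esym;
    [exact: m1'E|exact: m2'E].
transitivity (\int[m1]_x (m2' \o xsection S) x).
  by apply: eq_measure_integral => A _ _; exact: m1'E.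
by apply: eq_integral => x _; exact: m2'E.
Qed.

End finite_measures.

(** * Probability that both links support the target rate *)

Section success_probability.
Context {R : realType}.
Local Open Scope ereal_scope.
Local Notation mu := (@lebesgue_measure R).
Local Notation RR := (measurableTypeR R).

(** The event on [X] contributes [expR (- a)]. For [cabs2 (Z w) = z] fixed, the event on [Y] is an
    exponential tail of mass [expR (- (c + b * z))], and [expR (- (b * z))] has mean [1 / (1 + b)]
    under the rate 1 law. *)
Lemma success_probability {d} {T : measurableType d} (P : probability T R)
    (X Y Z : T -> R * R) (a b c : R) :
  (0 <= a)%R -> (0 <= b)%R -> (0 <= c)%R ->
  is_CN01 P X -> is_CN01 P Y -> is_CN01 P Z -> indep3 P X Y Z ->
  P [set w | (a <= cabs2 (X w))%R /\
             (c + b * cabs2 (Z w) <= cabs2 (Y w))%R] =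
  (expR (- (a + c)) / (1 + b))%:E.
Proof.
move=> a0 b0 c0 hX hY hZ indep.
have mC A : measurable A -> measurable (@cabs2 R @^-1` A).
  by move=> mA; rewrite -[X in measurable X]setTI; exact: measurable_cabs2.
have mcY : measurable_fun setT (fun w => cabs2 (Y w) : RR).
  by apply: (measurableT_comp measurable_cabs2); case: hY.
have mcZ : measurable_fun setT (fun w => cabs2 (Z w) : RR).
  by apply: (measurableT_comp measurable_cabs2); case: hZ.
pose E := X @^-1` (@cabs2 R @^-1` `[a, +oo[%classic).
have mAy : measurable (`[a, +oo[%classic : set R) by [].
have mE : measurable E.
  by rewrite -[X in measurable X]setTI; case: hX => + _; apply => //; exact: mC.
have PE : P E = (expR (- a))%:E.
  by rewrite CN01_cabs2_exponential// exponential_tail.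
pose phi w : RR * RR := (cabs2 (Z w), cabs2 (Y w)).
have mphi : measurable_fun setT phi by apply/measurable_fun_pairP; split.
(* Restricting [P] to [E] absorbs [X]: the factor [P E] goes into [m2], [m1] stays a probability
   law, and [m] is their product on rectangles. *)
pose Q : {measure set T -> \bar R} := mrestr P mE.
pose m := pushforward_measure Q mphi.
pose m1 := pushforward_measure P mcZ.
pose m2 := pushforward_measure Q mcY.
have m1E A : measurable A -> m1 A = exponential_prob 1 A.
  by move=> mA; rewrite -(CN01_cabs2_exponential P Z).
have m2E A : measurable A -> m2 A = (expR (- a))%:E * exponential_prob 1 A.
  move=> mA; rewrite -(CN01_cabs2_exponential P Y)// -PE.
  (* The whole space for [Z] gives the independence of [X] and [Y]. *)
  have := indep _ _ _ (mC _ mAy) (mC _ mA) measurableT.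
  by rewrite preimage_setT probability_setT mule1 setIT setIC => <-.
have mrect A B : measurable A -> measurable B -> m (A `*` B) = m1 A * m2 B.
  move=> mA mB; rewrite m1E// m2E// -(CN01_cabs2_exponential P Z)//.
  rewrite -(CN01_cabs2_exponential P Y)// -PE muleC.
  rewrite -(indep _ _ _ (mC _ mAy) (mC _ mB) (mC _ mA)).
  rewrite /m /= /pushforward /mrestr; congr (P _).
  by apply/seteqP; split => w /= [[]].
(* The truncation at 0 is harmless, squared moduli being nonnegative, and makes
   the sections of [S] tails of the half-line. *)
pose S : set (RR * RR) := [set p | (c + b * Num.max p.1 0 <= p.2)%R].
have mS : measurable S.
  have -> : S = (fun p : RR * RR => p.2 - (c + b * Num.max p.1 0))%R @^-1`
      `[0%R, +oo[%classic.
    by apply/seteqP; split => p; rewrite /S /= in_itv /= andbT subr_ge0.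
  rewrite -[X in measurable X]setTI.
  have mmax : measurable_fun setT (fun p : RR * RR => Num.max p.1 0%R : R).
    by apply: (@measurable_maxr _ _ R).
  suff : measurable_fun setT
      (fun p : RR * RR => p.2 - (c + b * Num.max p.1 0) : R)%R by apply.
  apply: (@measurable_funB _ _ R) => //; apply: (@measurable_funD _ _ R) => //.
  exact: (@measurable_funM _ _ R).
have -> : [set w | (a <= cabs2 (X w))%R /\
    (c + b * cabs2 (Z w) <= cabs2 (Y w))%R] = phi @^-1` S `&` E.
  apply/seteqP; split => w; rewrite /E /S /phi /= in_itv /= andbT;
    by rewrite max_l ?cabs2_ge0// => -[].
have m1T : m1 setT < +oo.
  by rewrite m1E// /exponential_prob integral_exponential_pdf// ltry.
have m2T : m2 setT < +oo.
  by rewrite m2E// /exponential_prob integral_exponential_pdf// mule1 ltry.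
transitivity (m S) => //.
rewrite (measure_of_rectangles m m1 m2)//.
pose f z := (expR (- (a + c)) * expR (- (b * Num.max z 0%R)))%:E : \bar R.
have mf : measurable_fun setT f.
  apply/measurable_EFinP; apply: measurable_funM => //.
  apply: measurableT_comp => //; apply: measurableT_comp => //.
  by apply: measurable_funM => //; exact: measurable_maxr.
have -> : \int[m1]_z m2 (xsection S z) = \int[m1]_z f z.
  apply: eq_integral => z _.
  have -> : xsection S z = `[(c + b * Num.max z 0%R)%R, +oo[%classic.
    apply/seteqP; split => y /=; rewrite in_itv /= andbT.
      by move/xsectionP.
    by move=> cby; apply/xsectionP.
  rewrite m2E// exponential_tail; last first.
    by rewrite addr_ge0// mulr_ge0// le_max lexx orbT.
  by rewrite /f -EFinM -!expRD; congr (expR _)%:E; ring.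
have mpdf r : measurable_fun setT (fun z : RR => (exponential_pdf r z)%:E).
  by apply: measurableT_comp => //; exact: measurable_exponential_pdf.
rewrite (ge0_integral_density m1 mu f _ m1T (mpdf 1%R))//; last first.
  by move=> z; rewrite lee_fin mulr_ge0 ?expR_ge0.
have b1 : (0 < 1 + b)%R by rewrite ltr_pwDl.
(* Exponential tilting: up to the factor [1 / (1 + b)], the product of [expR (- (b * z))] with the
   rate 1 density is the density of rate [1 + b], of total mass 1. *)
transitivity (\int[mu]_z ((expR (- (a + c)) / (1 + b))%:E *
    (exponential_pdf (1 + b) z)%:E)).
  apply: eq_integral => z _; rewrite /f -!EFinM; congr EFin.
  have [z0|z0] := leP 0%R z; last by rewrite !lt0_exponential_pdf// !mulr0.
  rewrite !exponential_pdfE// mul1r mulN1r.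
  have -> : (- (1 + b) * z = - (b * z) + - z)%R by ring.
  by rewrite expRD; field; rewrite gt_eqF.
rewrite ge0_integralZl//.
- by rewrite integral_exponential_pdf// mule1.
- by move=> z _; rewrite lee_fin exponential_pdf_ge0// ltW.
- by rewrite lee_fin divr_ge0 ?expR_ge0// ltW.
Qed.

End success_probability.

(** * Closed form of the outage probability *)

Section outage_probability.
Context {R : realType}.

Lemma measurable_success {d} {T : measurableType d} {P : probability T R}
    (X Y Z : T -> R * R) (a b c : R) :
  is_CN01 P X -> is_CN01 P Y -> is_CN01 P Z ->
  measurable [set w | a <= cabs2 (X w) /\ c + b * cabs2 (Z w) <= cabs2 (Y w)].
Proof.
move=> [mX _] [mY _] [mZ _].
have mcabs2 (h : T -> R * R) :
    measurable_fun setT h -> measurable_fun setT (@cabs2 R \o h).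
  by move=> mh; apply: (measurableT_comp measurable_cabs2).
have mnonneg (f : T -> R) :
    measurable_fun setT f -> measurable [set w | 0 <= f w].
  move=> mf; have -> : [set w | 0 <= f w] = f @^-1` `[0, +oo[%classic.
    by apply/seteqP; split => w /=; rewrite in_itv /= andbT.
  by rewrite -[X in measurable X]setTI; exact: mf.
have -> : [set w | a <= cabs2 (X w) /\ c + b * cabs2 (Z w) <= cabs2 (Y w)] =
    [set w | 0 <= cabs2 (X w) - a] `&`
    [set w | 0 <= cabs2 (Y w) - (c + b * cabs2 (Z w))].
  by apply/seteqP; split => w /=; rewrite !subr_ge0.
apply: measurableI; apply: mnonneg.
  by apply: measurable_funB => //; exact: mcabs2.
apply: measurable_funB; first exact: mcabs2.
by apply: measurable_funD => //; apply: measurable_funM => //; exact: mcabs2.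
Qed.

Lemma subr1_powR2_ge0 (r : R) : 0 <= r -> 0 <= 2 `^ r - 1 :> R.
Proof. by move=> r0; rewrite subr_ge0 -[leLHS](powRr0 2) ler_powR// ler1n. Qed.

Lemma le_log2 (r u : R) : 0 < u -> (r <= log2 u) = (2 `^ r <= u).
Proof.
move=> u0; have ln20 : 0 < ln (2 : R) by rewrite ln_gt0// ltr1n.
rewrite /log2 ler_pdivlMr// /powR gt_eqF//.
by rewrite -{2}(lnK (x := u)) ?posrE// ler_expR.
Qed.

(** Since [Rt > 0], no maximum with 0 reaches [Rt] through its 0; exponentiating then makes the
    conditions linear in the squared moduli. *)
Lemma le_rate1 (alpha gD gE Rt : R) (x y z : R * R) :
  0 < alpha -> 0 < gD -> 0 < gE -> 0 < Rt ->
  (Rt <= rate1 alpha gD gE x y z) =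
  ((2 `^ Rt - 1) / (alpha * gD) <= cabs2 x) &&
  ((2 `^ Rt - 1) / gD + 2 `^ Rt * gE / gD * cabs2 z <= cabs2 y).
Proof.
move=> alpha0 gD0 gE0 Rt0.
have x0 := cabs2_ge0 x; have y0 := cabs2_ge0 y; have z0 := cabs2_ge0 z.
have x1 : 0 < 1 + alpha * gD * cabs2 x by rewrite ltr_pwDl// !mulr_ge0// ltW.
have y1 : 0 < 1 + gD * cabs2 y by rewrite ltr_pwDl// mulr_ge0// ltW.
have z1 : 0 < 1 + gE * cabs2 z by rewrite ltr_pwDl// mulr_ge0// ltW.
rewrite /rate1 /rate_RD /rate_SR !(le_max, le_min) (leNgt Rt 0) Rt0 /= !orbF.
rewrite !le_log2 ?divr_gt0// andbC; congr (_ && _).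
  by rewrite ler_pdivrMr ?mulr_gt0// lerBlDl mulrC.
rewrite ler_pdivlMr// -[RHS](ler_pM2l gD0) -[RHS](lerD2l 1).
by congr (_ <= _); field; rewrite gt_eqF.
Qed.

(** Outage is the complement of the success event; the thresholds [a] and [c] add up to the exponent
    shown. *)
Lemma P1E {d} {T : measurableType d} {P : probability T R}
    (hSR hRD hRE : T -> R * R) (gE Rt alpha gD : R) :
  0 < gE -> 0 < Rt -> 0 < alpha -> 0 < gD ->
  is_CN01 P hSR -> is_CN01 P hRD -> is_CN01 P hRE ->
  indep3 P hSR hRD hRE ->
  P1 P hSR hRD hRE alpha gE Rt gD =
  1 - expR (- ((2 `^ Rt - 1) * (1 + 1 / alpha) / gD)) /
      (1 + 2 `^ Rt * gE / gD).
Proof.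
move=> gE0 Rt0 alpha0 gD0 hX hY hZ indep.
have c0 := subr1_powR2_ge0 Rt (ltW Rt0).
pose a := (2 `^ Rt - 1) / (alpha * gD); pose c := (2 `^ Rt - 1) / gD.
pose b := 2 `^ Rt * gE / gD.
have a0 : 0 <= a by rewrite divr_ge0// mulr_ge0// ltW.
have b0 : 0 <= b by rewrite divr_ge0 ?mulr_ge0 ?powR_ge0// ltW.
have cg0 : 0 <= c by rewrite divr_ge0// ltW.
rewrite /P1.
have -> : [set w | rate1 alpha gD gE (hSR w) (hRD w) (hRE w) < Rt] =
    ~` [set w | a <= cabs2 (hSR w) /\ c + b * cabs2 (hRE w) <= cabs2 (hRD w)].
  apply/seteqP; split => w /=; rewrite ltNge le_rate1//.
    by move=> /negP h [? ?]; apply: h; apply/andP.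
  by move=> h; apply/negP => /andP.
rewrite probability_setC; last exact: measurable_success hX hY hZ.
rewrite success_probability//= -/b; congr (1 - expR _ / _).
by rewrite /a /c; field; rewrite !gt_eqF.
Qed.

End outage_probability.

(** * First-order expansion at high average SNR *)

Section asymptotics.
Context {R : realType}.

(** The gap to 1 is [k / (g + k)], of modulus at most [e] once [g + k > 0] and
    [g >= |k| / e - k]. *)
Lemma cvg_div_addr_pinfty (k : R) : g / (g + k) @[g --> +oo] --> (1 : R).
Proof.
apply/cvgrPdist_le => e e0; near=> g.
have gk : 0 < g + k.
  by rewrite -ltrBlDr sub0r; near: g; apply: nbhs_pinfty_gt; exact: num_real.
have -> : 1 - g / (g + k) = k / (g + k) by field; rewrite gt_eqF.
rewrite normrM normfV (gtr0_norm gk) ler_pdivrMr// mulrC -ler_pdivrMr//.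
rewrite -lerBlDr; near: g; apply: nbhs_pinfty_ge; exact: num_real.
Unshelve. all: by end_near. Qed.

(* Squeeze with [x / (1 + x) <= 1 - expR (- x) <= x] at [x = a / g]. *)
Lemma cvg_outage_expansion (a b : R) : 0 <= a -> 0 <= b ->
  g * (1 - expR (- (a / g)) / (1 + b / g)) @[g --> +oo] --> a + b.
Proof.
move=> a0 b0.
apply: (@squeeze_cvgr _ _ _ _
  (fun g => (a * (g / (g + a)) + b) * (g / (g + b)))
  (fun g => (a + b) * (g / (g + b)))).
- near=> g; have g0 : 0 < g by near: g; exact: nbhs_pinfty_gt.
  have ga0 : 0 < g + a by rewrite ltr_wpDr.
  have gb0 : 0 < g + b by rewrite ltr_wpDr.
  (* With [g / (g + b)] factored out as in both bounds, only [g * (1 - expR (- (a / g)))] remains to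
     be compared with [a * (g / (g + a))] and [a]. *)
  have -> : g * (1 - expR (- (a / g)) / (1 + b / g)) =
      (g * (1 - expR (- (a / g))) + b) * (g / (g + b)).
    by field; rewrite !gt_eqF.
  have gb : 0 <= g / (g + b) by rewrite divr_ge0// ltW.
  apply/andP; split; rewrite ler_wpM2r// lerD2r.
    (* This is [1 + a / g <= expR (a / g)], inverted. *)
    have le1 : expR (- (a / g)) <= g / (g + a).
      rewrite expRN -[leRHS]invf_div lef_pV2 ?posrE ?expR_gt0 ?divr_gt0//.
      by apply: le_trans (expR_ge1Dx _); rewrite mulrDl divff ?gt_eqF.
    rewrite mulrC -mulrA ler_pM2l//.
    have -> : (g + a)^-1 * a = 1 - g / (g + a) by field; rewrite gt_eqF.
    by rewrite lerB.
  have aE : g * (a / g) = a by field; rewrite gt_eqF.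
  rewrite -[leRHS]aE ler_pM2l// lerBlDr addrC -lerBlDr.
  exact: expR_ge1Dx.
- rewrite -[X in _ --> X]mulr1; apply: cvgM; last exact: cvg_div_addr_pinfty.
  apply: cvgD; last exact: cvg_cst.
  rewrite -[X in _ --> X]mulr1; apply: cvgM; last exact: cvg_div_addr_pinfty.
  exact: cvg_cst.
- rewrite -[X in _ --> X]mulr1; apply: cvgM; last exact: cvg_div_addr_pinfty.
  exact: cvg_cst.
Unshelve. all: by end_near. Qed.

End asymptotics.

(** * Limit of the scaled outage probability *)

Theorem theorem2 (d : measure_display) (T : measurableType d) (R : realType)
  (P : probability T R) (hSR hRD hRE : T -> R * R)
  (gE Rt alpha : R) :
  0 < gE -> 0 < Rt -> 0 < alpha ->
  is_CN01 P hSR -> is_CN01 P hRD -> is_CN01 P hRE ->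
  indep3 P hSR hRD hRE ->
  0 < M1 alpha gE Rt /\
  (fun gD : R => gD * P1 P hSR hRD hRE alpha gE Rt gD) @ +oo
    --> M1 alpha gE Rt.
Proof.
move=> gE0 Rt0 alpha0 hX hY hZ indep.
have c0 := subr1_powR2_ge0 Rt (ltW Rt0).
have a0 : 0 <= (2 `^ Rt - 1) * (1 + 1 / alpha).
  by rewrite mulr_ge0// addr_ge0// divr_ge0// ltW.
have b0 : 0 < 2 `^ Rt * gE by rewrite mulr_gt0// powR_gt0.
split; first by rewrite /M1 ltr_wpDl.
apply: cvg_trans (cvg_outage_expansion _ _ a0 (ltW b0)).
(* The closed form is available for [g > 0], hence eventually. *)
apply: near_eq_cvg; near=> g.
by rewrite P1E//; near: g; exact: nbhs_pinfty_gt.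
Unshelve. all: by end_near. Qed.
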